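(* Let $X$ be a Banach space and $r\in[0,2]$. If for every $\delta>0$ there exists a Banach space $Y$ which is isomorphic to $X$ such that $d(X,Y)<1+\delta$ and $\mathcal T^s(Y)=r$, then $\mathcal T^s(X)\geq r$.
   Context: All Banach spaces are nontrivial and real. $B_X$ and $S_X$ denote the closed unit ball and the unit sphere of $X$, $X^*$ is the dual, and $B(x,\rho)$ is the ball with center $x$ and radius $\rho$. A slice of $B_X$ is a set $S(B_X,x^*,\alpha)=\{x\in B_X: x^*(x)>1-\alpha\}$ with $x^*\in S_{X^*}$ and $\alpha>0$. $\mathcal T^s(X)=\inf\{\rho>0:$ there exist $x\in S_X$ and a slice $S$ of $B_X$ such that $S\subset B(x,\rho)\}$. The Banach--Mazur distance between isomorphic Banach spaces $X$ and $Y$ is $d(X,Y)=\inf\{\|L\|\|L^{-1}\|: L:X\to Y\text{ is an isomorphism}\}$. *)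

(* Defs.v *)
From HB Require Import structures.
From mathcomp Require Import all_boot all_order all_algebra.
From mathcomp Require Import all_classical all_reals all_analysis.

Set Implicit Arguments.
Unset Strict Implicit.
Unset Printing Implicit Defensive.

Import Order.TTheory GRing.Theory Num.Theory.
Import numFieldNormedType.Exports.

Local Open Scope classical_set_scope.
Local Open Scope ring_scope.

Definition nontrivial_space (R : realType) (X : normedModType R) : Prop :=
  exists x : X, x != 0.

Definition unit_ball (R : realType) (X : normedModType R) : set X :=
  [set x | `|x| <= 1].
Arguments unit_ball {R} X.

Definition unit_sphere (R : realType) (X : normedModType R) : set X :=
  [set x | `|x| = 1].
Arguments unit_sphere {R} X.

(* The real-valued [sup] is the operator norm only for bounded [f]; below it is
   always used together with linearity and continuity of [f]. *)
Definition op_norm (R : realType) (X Y : normedModType R) (f : X -> Y) : R :=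
  sup [set `|f x| | x in unit_ball X].

Definition dual_sphere (R : realType) (X : normedModType R) :
    set {linear X -> R^o} :=
  [set f : {linear X -> R^o} | continuous f /\ op_norm f = 1].
Arguments dual_sphere {R} X.

Definition slice (R : realType) (X : normedModType R)
    (f : {linear X -> R^o}) (alpha : R) : set X :=
  [set x | unit_ball X x /\ 1 - alpha < f x].

Definition is_slice (R : realType) (X : normedModType R) (S : set X) : Prop :=
  exists (f : {linear X -> R^o}) (alpha : R),
    [/\ dual_sphere X f, 0 < alpha & S = slice f alpha].

(* The set under [inf] is bounded below by 0 and contains every rho > 2 as soon
   as X is nontrivial; since it is an infimum over rho, using open balls or
   closed balls gives the same value. *)
Definition Ts (R : realType) (X : normedModType R) : R :=
  inf [set rho : R | 0 < rho /\
    exists (x : X) (S : set X),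
      [/\ unit_sphere X x, is_slice S & S `<=` ball x rho]].

(* An isomorphism is given together with its inverse. *)
Definition isomorphism (R : realType) (X Y : normedModType R)
    (L : {linear X -> Y}) (Linv : {linear Y -> X}) : Prop :=
  [/\ cancel L Linv, cancel Linv L, continuous L & continuous Linv].

Definition isomorphic (R : realType) (X Y : normedModType R) : Prop :=
  exists (L : {linear X -> Y}) (Linv : {linear Y -> X}), isomorphism L Linv.

(* Meaningful only when X and Y are isomorphic: [inf set0] is 0. *)
Definition banach_mazur (R : realType) (X Y : normedModType R) : R :=
  inf [set d : R | exists (L : {linear X -> Y}) (Linv : {linear Y -> X}),
    isomorphism L Linv /\ d = op_norm L * op_norm Linv].

(* Main.v *)
Require Import Defs.
From HB Require Import structures.
From mathcomp Require Import all_boot all_order all_algebra.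
From mathcomp Require Import all_classical all_reals all_analysis.
From mathcomp Require Import lra.

(* Suppose a slice S(f, alpha) of B_X lies in B(x, rho) with |x| = 1 and
   rho < r. Rescale an almost isometry to M : X -> Y with inverse N, |N| <= 1
   and |M| <= 1 + delta. The functional g = f \o N has norm in
   [1 / (1 + delta), 1], so for small delta the slice S(g / |g|, alpha / 2) of
   B_Y is mapped by N into S(f, alpha), hence lies in
   B(M x, (1 + delta) rho). As M x is within delta of the unit sphere,
   Ts Y <= (1 + delta) rho + delta, which is < r for small delta. *)

Set Implicit Arguments.
Unset Strict Implicit.
Unset Printing Implicit Defensive.

Import Order.TTheory GRing.Theory Num.Theory.
Import numFieldNormedType.Exports.

Local Open Scope classical_set_scope.
Local Open Scope ring_scope.

(** Named so that [Ts X] is convertible to [inf (Ts_radii X)] and lemmas on infima apply. *)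
Definition Ts_radii (R : realType) (X : normedModType R) : set R :=
  [set rho : R | 0 < rho /\
    exists (x : X) (S : set X),
      [/\ unit_sphere X x, is_slice S & S `<=` ball x rho]].
Arguments Ts_radii {R} X.

Lemma Ts_radii_lbound (R : realType) (X : normedModType R) :
  lbound (Ts_radii X) 0.
Proof. by move=> rho [/ltW]. Qed.

Lemma Ts_ge0 (R : realType) (X : normedModType R) : 0 <= Ts X.
Proof.
rewrite -[Ts X]/(inf (Ts_radii X)).
(* With no admissible radius, [inf set0] takes the default value 0. *)
have [->|/set0P ne] := eqVneq (Ts_radii X) set0; first by rewrite inf0.
by apply: lb_le_inf => //; exact: Ts_radii_lbound.
Qed.

Section OperatorNorm.
Variables (R : realType) (X Y : normedModType R) (f : {linear X -> Y}).

Lemma op_norm_le (c : R) :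
  0 <= c -> (forall x, `|f x| <= c * `|x|) -> op_norm f <= c.
Proof.
move=> c0 fc; apply: ge_sup.
  by exists `|f 0|, 0 => //; rewrite /unit_ball /= normr0.
move=> _ [x xB <-]; apply: le_trans (fc x) _.
by rewrite ler_piMr.
Qed.

Hypothesis fcont : continuous f.

Lemma op_norm_has_ubound : has_ubound [set `|f x| | x in unit_ball X].
Proof.
have /linear_boundedP : bounded_near f (nbhs (0 : X)).
  by apply: continuous_linear_bounded; exact: fcont.
(* Every constant strictly above [y] is a Lipschitz bound, hence [y + 1]; the maximum with 0 makes
   it nonnegative, so it also bounds [f] on the ball. *)
move=> [y [yreal fy]]; exists (Num.max 0 (y + 1)) => _ [x xB <-].
apply: le_trans (fy (Num.max 0 (y + 1)) _ x) _.
  by rewrite lt_max ltrDl ltr01 orbT.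
by rewrite ler_piMr // le_max lexx.
Qed.

Lemma op_norm_ge0 : 0 <= op_norm f.
Proof.
apply: (ub_le_sup op_norm_has_ubound).
by exists 0; rewrite /unit_ball /= ?linear0 normr0.
Qed.

Lemma le_op_norm x : `|f x| <= op_norm f * `|x|.
Proof.
have [->|x0] := eqVneq x 0; first by rewrite linear0 !normr0 mulr0.
have nx : 0 < `|x| by rewrite normr_gt0.
rewrite -ler_pdivrMr //; apply: (ub_le_sup op_norm_has_ubound).
exists (`|x|^-1 *: x).
  by rewrite /unit_ball /= normrZ normfV normr_id mulVf ?normr_eq0.
by rewrite linearZ normrZ normfV normr_id mulrC.
Qed.

End OperatorNorm.

Lemma bounded_continuous (R : realType) (X Y : normedModType R)
    (f : {linear X -> Y}) (c : R) :
  (forall x, `|f x| <= c * `|x|) -> continuous f.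
Proof.
move=> fc; apply: bounded_linear_continuous; apply/linear_boundedP.
exists c; split; first exact: num_real.
by move=> d cd x; apply: le_trans (fc x) _; rewrite ler_wpM2r // ltW.
Qed.

(** Slices require functionals of norm one, so a functional pulled back along an isomorphism must
    first be divided by its norm. *)
Lemma dual_sphere_normalize (R : realType) (X : normedModType R)
    (g : {linear X -> R^o}) :
  continuous g -> 0 < op_norm g ->
  exists2 h : {linear X -> R^o}, dual_sphere X h &
    forall x, g x = op_norm g * h x.
Proof.
move=> gc t0; set t := op_norm g in t0 *.
pose h : {linear X -> R^o} := t^-1 \*: g.
have gh x : g x = t * h x.
  by rewrite /h /= /GRing.scale /= mulrA divff ?mul1r ?gt_eqF.
have hb x : `|h x| <= 1 * `|x|.
  rewrite /h /= normrZ normfV (gtr0_norm t0) mul1r mulrC ler_pdivrMr // mulrC.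
  exact: le_op_norm.
have hc : continuous h by exact: bounded_continuous hb.
exists h => //; split => //; apply/eqP; rewrite eq_le op_norm_le //=.
(* For [1 <= op_norm h]: as [g = t h], the constant [t * op_norm h] bounds [g], so it is at least
   [op_norm g = t]. *)
rewrite -(ler_pM2l t0) mulr1; apply: op_norm_le => [|x].
  by rewrite mulr_ge0 ?op_norm_ge0 // ltW.
by rewrite gh normrM (gtr0_norm t0) -mulrA ler_wpM2l ?le_op_norm // ltW.
Qed.

Lemma op_norm_gt0 (R : realType) (X Y : normedModType R)
    (f : {linear X -> Y}) (x : X) :
  continuous f -> f x != 0 -> 0 < op_norm f.
Proof.
move=> fc fx; rewrite lt_neqAle op_norm_ge0 // andbT; apply/eqP => f0.
by have := le_op_norm fc x; rewrite -f0 mul0r normr_le0 (negbTE fx).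
Qed.

Lemma dual_sphere_ne0 (R : realType) (X : normedModType R)
    (f : {linear X -> R^o}) :
  dual_sphere X f -> exists x, f x != 0.
Proof.
move=> [_ f1]; apply: contrapT => /forallNP f0.
have : op_norm f <= 0.
  apply: op_norm_le => // x; have /negP := f0 x.
  by rewrite negbK => /eqP ->; rewrite normr0 mul0r.
by rewrite f1 ler10.
Qed.

Lemma Ts_radii_nonempty (R : realType) (X : normedModType R)
    (f : {linear X -> R^o}) :
  nontrivial_space X -> dual_sphere X f -> Ts_radii X !=set0.
Proof.
(* Two points of the unit ball are at distance at most 2, so radius 3 suffices for any slice and any
   center on the sphere. *)
move=> [x x0] fS; exists 3; split => //.
exists (`|x|^-1 *: x), (slice f 1); split; last 1 first.
- move=> y [yB _]; rewrite -ball_normE /=.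
  apply: le_lt_trans (ler_normB _ _) _.
  rewrite normrZ normfV normr_id mulVf ?normr_eq0 //.
  by move: yB; rewrite /unit_ball /=; lra.
- by rewrite /unit_sphere /= normrZ normfV normr_id mulVf ?normr_eq0.
- by exists f, 1.
Qed.

Lemma Ts_le_perturb (R : realType) (X Y : normedModType R)
    (M : {linear X -> Y}) (N : {linear Y -> X}) (delta alpha rho : R)
    (f : {linear X -> R^o}) (x : X) :
  cancel M N -> cancel N M ->
  (forall z, `|M z| <= (1 + delta) * `|z|) -> (forall y, `|N y| <= `|y|) ->
  0 < delta -> delta <= alpha / 2 ->
  dual_sphere X f -> unit_sphere X x -> 0 < rho ->
  slice f alpha `<=` ball x rho ->
  Ts Y <= (1 + delta) * rho + delta.
Proof.
move=> MK NK Mb Nb d0 da [fc f1] x1 rho0 Sx.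
rewrite /unit_sphere /= in x1.
have fb z : `|f z| <= `|z| by rewrite -[leRHS]mul1r -f1 le_op_norm.
pose g : {linear Y -> R^o} := f \o N.
have gb y : `|g y| <= 1 * `|y|.
  by rewrite mul1r; exact: le_trans (fb _) (Nb _).
have gc : continuous g by exact: bounded_continuous gb.
have g1 : op_norm g <= 1 by exact: op_norm_le.
have g0 := op_norm_ge0 gc.
(* Since [f = g \o M], the norm 1 of [f] is at most [op_norm g * (1 + delta)]. *)
have gd : 1 <= op_norm g * (1 + delta).
  rewrite -{1}f1; apply: op_norm_le => [|z]; first by rewrite mulr_ge0 //; lra.
  have -> : f z = g (M z) by rewrite /g /= MK.
  by apply: le_trans (le_op_norm gc _) _; rewrite -mulrA ler_wpM2l.
have gpos : 0 < op_norm g by nra.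
have [h hS gh] := dual_sphere_normalize gc gpos.
set t := op_norm g in g1 g0 gd gpos gh.
have Mx : `|M x| <= 1 + delta by rewrite (le_trans (Mb x)) // x1 mulr1.
(* [N] does not increase norms and sends [M x] back to [x]. *)
have Mx1 : 1 <= `|M x| by rewrite -x1 -{1}(MK x).
have Mx0 : `|M x| != 0 by lra.
apply: ge_inf; first by exists 0; exact: Ts_radii_lbound.
split; first by nra.
exists (`|M x|^-1 *: M x), (slice h (alpha / 2)); split.
- by rewrite /unit_sphere /= normrZ normfV normr_id mulVf.
- by exists h, (alpha / 2); split => //; lra.
move=> y [yB hy]; rewrite -ball_normE /=.
have : ball x rho (N y).
  apply: Sx; split; first exact: le_trans (Nb y) yB.
  rewrite -[f _]/(g y) gh.
  (* From [1 - alpha / 2 <= t <= 1] follows [t * (1 - alpha / 2) >= t - alpha / 2 >= 1 - alpha]. *)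
  have : t * (1 - alpha / 2) < t * h y by rewrite ltr_pM2l.
  have : 1 - alpha / 2 <= t by nra.
  have : (1 - t) * alpha >= 0 by rewrite mulr_ge0; lra.
  nra.
rewrite -ball_normE /= => xNy.
have My : `|M x - y| < (1 + delta) * rho.
  rewrite -{1}(NK y) -linearB (le_lt_trans (Mb _)) // ltr_pM2l //; lra.
(* The norm equals [|M x| - 1], which lies between 0 and [delta]. *)
have near_sphere : `|(`|M x|^-1 *: M x - M x)| <= delta.
  rewrite -[X in _ - X]scale1r -scalerBl normrZ -[X in _ * X]normr_id -normrM.
  rewrite mulrBl mulVf // mul1r distrC ger0_norm; lra.
have -> : `|M x|^-1 *: M x - y = (`|M x|^-1 *: M x - M x) + (M x - y).
  by rewrite addrA subrK.
by rewrite (le_lt_trans (ler_normD _ _)) //; lra.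
Qed.

(** Some isomorphism [L] with inverse [K] has product of norms below [c]. Multiplying [L] by the
    norm of [K], and dividing [K] by it, shifts the whole distortion onto [M]. *)
Lemma banach_mazur_rescale (R : realType) (X Y : normedModType R) (c : R) :
  nontrivial_space X -> isomorphic X Y -> banach_mazur X Y < c ->
  exists (M : {linear X -> Y}) (N : {linear Y -> X}),
    [/\ cancel M N, cancel N M, forall z, `|M z| <= c * `|z|
      & forall y, `|N y| <= `|y| ].
Proof.
move=> [x x0] [L0 [K0 iso0]] /inf_lt[].
  by exists (op_norm L0 * op_norm K0), L0, K0.
move=> _ [L [K [[LK KL Lc Kc] ->]]] abc.
have a0 : 0 < op_norm L.
  by apply: (@op_norm_gt0 _ _ _ _ x) => //; rewrite -(linear0 L) (can_eq LK).
have b0 : 0 < op_norm K by apply: (@op_norm_gt0 _ _ _ _ (L x)); rewrite ?LK.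
set a := op_norm L in abc a0; set b := op_norm K in abc b0.
have bn0 : b != 0 by rewrite gt_eqF.
exists (b \*: L), (b^-1 \*: K); split => [z|y|z|y] /=.
- by rewrite linearZ /= LK scalerA mulVf // scale1r.
- by rewrite linearZ /= KL scalerA divff // scale1r.
- rewrite normrZ (gtr0_norm b0).
  apply: (@le_trans _ _ (a * b * `|z|)); last by rewrite ler_wpM2r // ltW.
  by rewrite (mulrC a) -mulrA ler_pM2l // le_op_norm.
- by rewrite normrZ normfV (gtr0_norm b0) mulrC ler_pdivrMr // mulrC le_op_norm.
Qed.

Theorem proposition3p4 (R : realType) (X : completeNormedModType R) (r : R)
    (X_nontrivial : nontrivial_space X)
    (r_bounds : 0 <= r <= 2)
    (approx : forall delta : R, 0 < delta ->
      exists Y : completeNormedModType R,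
        [/\ nontrivial_space Y, isomorphic X Y,
            banach_mazur X Y < 1 + delta & Ts Y = r]) :
  r <= Ts X.
Proof.
rewrite leNgt; apply/negP => TsXr.
have Xradii : Ts_radii X !=set0.
  (* As [Ts Y = r > 0] is not the junk value [inf set0], [Y] has a norm-one
     functional; pulling it back to [X] avoids the Hahn-Banach theorem. *)
  have [Y [_ [L [K [LK KL Lc Kc]]] _ TsY]] := approx 1 ltr01.
  have [rho [_ [_ [_ [_ [f [_ [fS _ _]]] _]]]]] : Ts_radii Y !=set0.
    apply/set0P/eqP => Y0; move: TsXr; rewrite -TsY.
    by rewrite -[Ts Y]/(inf (Ts_radii Y)) Y0 inf0 ltNge Ts_ge0.
  have [y fy] := dual_sphere_ne0 fS.
  pose g : {linear X -> R^o} := f \o L.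
  have gc : continuous g.
    by move=> x; apply: continuous_comp; [exact: Lc|exact: fS.1].
  have g0 : 0 < op_norm g.
    by apply: (@op_norm_gt0 _ _ _ g (K y)) => //; rewrite /g /= KL.
  have [h hS _] := dual_sphere_normalize gc g0.
  exact: Ts_radii_nonempty hS.
have [rho [rho0 [x [_ [x1 [f [alpha [fS alpha0 ->]] Sx]]]]] rhor] :=
  inf_lt Xradii TsXr.
(* The first bound keeps the halved slice inside the original one; the second gives [(1 + delta) *
   rho + delta = rho + delta * (rho + 1) <= (rho + r) / 2 < r]. *)
pose delta := Num.min (alpha / 2) ((r - rho) / (2 * (rho + 1))).
have rhopos : 0 < 2 * (rho + 1) by lra.
have d0 : 0 < delta by rewrite lt_min !divr_gt0 //; lra.
have da : delta <= alpha / 2 by rewrite ge_min lexx.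
have dr : delta * (2 * (rho + 1)) <= r - rho.
  by rewrite -ler_pdivlMr // ge_min lexx orbT.
have [Y [_ iso dXY TsY]] := approx delta d0.
have [M [N [MK NK Mb Nb]]] := banach_mazur_rescale X_nontrivial iso dXY.
have := Ts_le_perturb MK NK Mb Nb d0 da fS x1 rho0 Sx.
by rewrite TsY; nra.
Qed.
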